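(* Let $C \subseteq \mathbb{R}^n$ be a closed convex set, let $\{\delta_k\}_{k \in \mathbb{N}}$ be a sequence of nonnegative real numbers with $\lim_{k \to \infty} \delta_k = 0$, and for every $k \in \mathbb{N}$ let $P_k \subseteq \mathbb{R}^n$ be a homogeneous $\delta_k$-approximation of $C$. Then the sequence $\{P_k\}_{k \in \mathbb{N}}$ converges to $C$ in the sense of Painlevé-Kuratowski.
   Context: A polyhedron is an intersection of finitely many closed halfspaces. $\operatorname{cone} M$ is the smallest convex cone containing $M$ (cones contain $0$; $\operatorname{cone}\emptyset = \{0\}$). The homogenization of a convex set $C \subseteq \mathbb{R}^n$ is $\operatorname{homog} C = \operatorname{cl}\operatorname{cone}(C \times \{1\}) \subseteq \mathbb{R}^{n+1}$. $B$ is the closed Euclidean unit ball of the appropriate dimension. The Hausdorff distance is $d_{\mathsf{H}}(C_1,C_2) = \max\{\sup_{x \in C_1} d(x,C_2), \sup_{x \in C_2} d(x,C_1)\}$ with $d(x,M) = \inf_{y \in M}\|x-y\|$. The truncated Hausdorff distance of convex cones is $d_{\mathsf{tH}}(K_1,K_2) = d_{\mathsf{H}}(K_1 \cap B, K_2 \cap B)$. For $\delta \geq 0$, a polyhedron $P \subseteq \mathbb{R}^n$ is a homogeneous $\delta$-approximation of $C$ if $d_{\mathsf{tH}}(\operatorname{homog} P, \operatorname{homog} C) \leq \delta$. For a sequence $\{M_k\}_{k \in \mathbb{N}}$ of subsets of $\mathbb{R}^n$, the outer limit $\limsup_{k\to\infty} M_k$ is the set of all $x \in \mathbb{R}^n$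 such that for every $\varepsilon > 0$ there is an infinite set $N \subseteq \mathbb{N}$ with $x \in M_k + \varepsilon B$ for all $k \in N$. The inner limit $\liminf_{k\to\infty} M_k$ is the set of all $x \in \mathbb{R}^n$ such that for every $\varepsilon > 0$ there is a set $N \subseteq \mathbb{N}$ with $\mathbb{N} \setminus N$ finite and $x \in M_k + \varepsilon B$ for all $k \in N$. The sequence converges to $M \subseteq \mathbb{R}^n$ in the sense of Painlevé-Kuratowski if $M = \limsup_{k \to \infty} M_k = \liminf_{k \to \infty} M_k$. *)

(* Defs.v *)
From HB Require Import structures.
From mathcomp Require Import all_boot all_order all_algebra.
From mathcomp Require Import all_classical all_reals.
From mathcomp Require Import ereal topology normedtype sequences convex.
Set Implicit Arguments.
Unset Strict Implicit.
Unset Printing Implicit Defensive.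
Import Order.TTheory GRing.Theory Num.Theory.
Import numFieldNormedType.Exports.
Local Open Scope classical_set_scope.
Local Open Scope ring_scope.

(* R^n is 'rV[R]_n. The library's norm on matrices is the sup norm, so the
   Euclidean norm is defined here; both induce the same topology, hence
   [closed] and [closure] are the library's. *)
Definition dotv (R : realType) (n : nat) (x y : 'rV[R]_n) : R :=
  \sum_(i < n) x 0 i * y 0 i.

Definition enorm (R : realType) (n : nat) (x : 'rV[R]_n) : R :=
  Num.sqrt (dotv x x).

Definition unit_ball (R : realType) (n : nat) : set 'rV[R]_n :=
  [set x | enorm x <= 1].

Definition closed_halfspace (R : realType) (n : nat) (H : set 'rV[R]_n) : Prop :=
  exists (a : 'rV[R]_n) (b : R), a != 0 /\ H = [set x | dotv a x <= b].

(* The empty family is allowed: its intersection is the whole space. *)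
Definition polyhedron (R : realType) (n : nat) (P : set 'rV[R]_n) : Prop :=
  exists F : set (set 'rV[R]_n),
    [/\ finite_set F, F `<=` @closed_halfspace R n & P = \bigcap_(H in F) H].

(* The library's [convex_set], at the vector space R^n. *)
Definition convex (R : realType) (n : nat) (A : set 'rV[R]_n) : Prop :=
  @convex_set R 'rV[R]_n A.

Definition convex_cone (R : realType) (n : nat) (K : set 'rV[R]_n) : Prop :=
  [/\ K 0, (forall (t : R) x, 0 <= t -> K x -> K (t *: x)) & convex K].

(* [smallest P M] is the intersection of all sets that satisfy P and
   contain M. *)
Definition cone (R : realType) (n : nat) (M : set 'rV[R]_n) : set 'rV[R]_n :=
  smallest (@convex_cone R n) M.

(* The set C x {1}. *)
Definition lift1 (R : realType) (n : nat) (C : set 'rV[R]_n) : set 'rV[R]_(n + 1) :=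
  [set row_mx x 1%:M | x in C].

Definition homog (R : realType) (n : nat) (C : set 'rV[R]_n) : set 'rV[R]_(n + 1) :=
  closure (cone (lift1 C)).

(* Distances take values in \bar R, so that suprema and infima always exist;
   the distance to the empty set is +oo. *)
Definition edist_to (R : realType) (n : nat) (x : 'rV[R]_n) (M : set 'rV[R]_n) : \bar R :=
  ereal_inf [set (enorm (x - y))%:E | y in M].

Definition hausdorff_dist (R : realType) (n : nat) (C1 C2 : set 'rV[R]_n) : \bar R :=
  Order.max (ereal_sup [set edist_to x C2 | x in C1])
            (ereal_sup [set edist_to x C1 | x in C2]).

Definition trunc_hausdorff_dist (R : realType) (n : nat) (K1 K2 : set 'rV[R]_n) : \bar R :=
  hausdorff_dist (K1 `&` @unit_ball R n) (K2 `&` @unit_ball R n).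

Definition homogeneous_approximation (R : realType) (n : nat) (delta : R)
    (P C : set 'rV[R]_n) : Prop :=
  [/\ 0 <= delta, polyhedron P &
      (trunc_hausdorff_dist (homog P) (homog C) <= delta%:E)%E].

(* The set M + eps B. *)
Definition fatten (R : realType) (n : nat) (M : set 'rV[R]_n) (eps : R) : set 'rV[R]_n :=
  [set y + eps *: b | y in M & b in @unit_ball R n].

Definition outer_limit (R : realType) (n : nat) (M : nat -> set 'rV[R]_n) : set 'rV[R]_n :=
  [set x | forall eps : R, 0 < eps ->
     exists N : set nat,
       infinite_set N /\ forall k, N k -> fatten (M k) eps x].

Definition inner_limit (R : realType) (n : nat) (M : nat -> set 'rV[R]_n) : set 'rV[R]_n :=
  [set x | forall eps : R, 0 < eps ->
     exists N : set nat,
       cofinite_set N /\ forall k, N k -> fatten (M k) eps x].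

Definition PK_converges (R : realType) (n : nat) (M : nat -> set 'rV[R]_n)
    (L : set 'rV[R]_n) : Prop :=
  L = outer_limit M /\ L = inner_limit M.

(* Main.v *)
(** A single one-sided estimate ([homog_near_point]) gives both inclusions: if
    [homog A] is within [d] of [homog B] inside the unit ball, then each point of
    [A] of norm less than [r] is within about [2 * r ^+ 2 * d] of [B].  With [A = C]
    and [B = P k] this shows that [C] is contained in the inner limit; with
    [A = P k] and [B = C], that points of [P k] staying in a bounded region approach
    the closed set [C], so that the outer limit is contained in [C]. *)
Require Import Defs.
From mathcomp Require Import all_boot all_order all_algebra.
From mathcomp Require Import all_classical all_reals.
From mathcomp Require Import ereal topology normedtype sequences convex.
From mathcomp Require Import interval_inference ring lra.
Import Order.TTheory GRing.Theory Num.Theory.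
Import numFieldNormedType.Exports.
Local Open Scope classical_set_scope.
Local Open Scope ring_scope.
Set Implicit Arguments.
Unset Strict Implicit.
Unset Printing Implicit Defensive.

(** * The Euclidean norm and its topology *)

Section EuclideanNorm.
Variables (R : realType) (n : nat).
Implicit Types (x y : 'rV[R]_n) (A : set 'rV[R]_n).

Lemma dotvC x y : dotv x y = dotv y x.
Proof. by apply: eq_bigr => i _; rewrite mulrC. Qed.

Lemma dotvDl x y z : dotv (x + y) z = dotv x z + dotv y z.
Proof. by rewrite -big_split; apply: eq_bigr => i _; rewrite mxE mulrDl. Qed.

Lemma dotvDr x y z : dotv z (x + y) = dotv z x + dotv z y.
Proof. by rewrite dotvC dotvDl !(dotvC z). Qed.

Lemma dotvZl t x y : dotv (t *: x) y = t * dotv x y.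
Proof. by rewrite mulr_sumr; apply: eq_bigr => i _; rewrite mxE mulrA. Qed.

Lemma dotvZr t x y : dotv y (t *: x) = t * dotv y x.
Proof. by rewrite dotvC dotvZl dotvC. Qed.

Lemma dotv_ge0 x : 0 <= dotv x x.
Proof. by apply: sumr_ge0 => i _; exact: sqr_ge0. Qed.

Lemma sqr_enorm x : enorm x ^+ 2 = dotv x x.
Proof. by rewrite sqr_sqrtr ?dotv_ge0. Qed.

Lemma enorm_ge0 x : 0 <= enorm x.
Proof. exact: sqrtr_ge0. Qed.

Lemma enormZ t x : enorm (t *: x) = `|t| * enorm x.
Proof.
by rewrite /enorm dotvZl dotvZr mulrA -expr2 sqrtrM ?sqr_ge0// sqrtr_sqr.
Qed.

Lemma enormN x : enorm (- x) = enorm x.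
Proof. by rewrite -scaleN1r enormZ normrN1 mul1r. Qed.

Lemma enormB x y : enorm (x - y) = enorm (y - x).
Proof. by rewrite -enormN opprB. Qed.

Lemma normr_coord_le_enorm x i : `|x 0 i| <= enorm x.
Proof.
rewrite -sqrtr_sqr ler_sqrt ?dotv_ge0// /dotv (bigD1 i)//= expr2 lerDl.
by apply: sumr_ge0 => j _; exact: sqr_ge0.
Qed.

Lemma enorm_eq0 x : enorm x = 0 -> x = 0.
Proof.
move=> x0; apply/rowP => i; rewrite mxE; apply/eqP.
by rewrite -normr_le0 -x0 normr_coord_le_enorm.
Qed.

(* Expanding [0 <= |(y.y) x - (x.y) y|^2]. *)
Lemma dotv_le_enormM x y : dotv x y <= enorm x * enorm y.
Proof.
have [y0|y0] := eqVneq (enorm y) 0.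
  by rewrite y0 mulr0 (enorm_eq0 y0) -(scale0r 0) dotvZr mul0r.
have yy0 : 0 < dotv y y by rewrite -sqr_enorm exprn_gt0// lt_neqAle eq_sym y0 enorm_ge0.
apply: le_trans (ler_norm _) _.
rewrite -(ler_pXn2r (n := 2))// ?nnegrE ?mulr_ge0 ?enorm_ge0//.
rewrite real_normK ?num_real// exprMn !sqr_enorm.
have := dotv_ge0 (dotv y y *: x - dotv x y *: y).
rewrite -scaleNr !(dotvDl, dotvDr, dotvZl, dotvZr) (dotvC y x).
set a := dotv x x; set b := dotv x y; set c := dotv y y in yy0 *.
rewrite [X in 0 <= X -> _](_ : _ = c * (a * c - b ^+ 2)); last by ring.
by rewrite pmulr_rge0// subr_ge0.
Qed.

Lemma ler_enormD x y : enorm (x + y) <= enorm x + enorm y.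
Proof.
rewrite -(ler_pXn2r (n := 2))// ?nnegrE ?addr_ge0 ?enorm_ge0//.
rewrite sqrrD !sqr_enorm dotvDl !dotvDr (dotvC y x).
by have := dotv_le_enormM x y; lra.
Qed.

Lemma ler_enorm_sub y x z : enorm (x - z) <= enorm (x - y) + enorm (y - z).
Proof. by rewrite -(subrKA y) ler_enormD. Qed.

(** The ambient topology comes from the sup norm; the two norms bound each other up to a factor
    depending on [n], so Euclidean balls detect the same closure. *)
Lemma closure_enormP A x :
  closure A x <-> forall e, 0 < e -> exists2 y, A y & enorm (x - y) < e.
Proof.
split=> [clA e e0|clA U].
  (* If all coordinates differ by less than [d], the squared distance is at most [n * d ^+ 2];
     dividing by [n + 1] keeps this strictly below [e ^+ 2] and covers [n = 0]. *)
  pose d := e / n.+1%:R.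
  have d0 : 0 < d by rewrite divr_gt0.
  have [y [Ay xy]] := clA _ (nbhsx_ballx x d d0).
  exists y => //.
  rewrite -[ltRHS]ger0_norm ?ltW// -sqrtr_sqr ltr_sqrt ?exprn_gt0//.
  apply: (@le_lt_trans _ _ (\sum_(i < n) d ^+ 2)).
    apply: ler_sum => i _; rewrite -expr2 -[leLHS]real_normK ?num_real//.
    by rewrite ler_pXn2r ?nnegrE ?(ltW d0)// !mxE ltW//; exact: (xy.2 0 i).
  rewrite sumr_const card_ord -mulr_natl.
  have -> : e = n.+1%:R * d by rewrite /d mulrC divfK.
  rewrite [ltRHS]exprMn ltr_pM2r ?exprn_gt0// -natrX ltr_nat.
  by rewrite (leq_trans (ltnSn n))// leq_pmulr.
rewrite -nbhs_ballE => -[e/= e0 xeU]; have [y Ay xy] := clA e e0.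
exists y; split=> //; apply: xeU; split=> // i j.
rewrite ord1 /ball/= /ball_ -[ltLHS]/(`|x 0 j - y 0 j|).
by have := normr_coord_le_enorm (x - y) j; rewrite !mxE => /le_lt_trans; apply.
Qed.

End EuclideanNorm.

Lemma enorm_row_mx (R : realType) (m n : nat) (x : 'rV[R]_m) (y : 'rV[R]_n) :
  enorm (row_mx x y) ^+ 2 = enorm x ^+ 2 + enorm y ^+ 2.
Proof.
rewrite !sqr_enorm /dotv big_split_ord/=.
by congr (_ + _); apply: eq_bigr => i _; rewrite ?row_mxEl ?row_mxEr.
Qed.

(** * Convexity and polyhedra *)

Lemma convexP (R : realType) (n : nat) (A : set 'rV[R]_n) :
  convex A <-> forall (t : R) x y, 0 <= t -> t <= 1 -> A x -> A y ->
    A (t *: x + (1 - t) *: y).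
Proof.
split=> [cA t x y t0 t1 Ax Ay|cA x y t].
  by have := cA x y (Itv01 t0 t1); rewrite !inE; exact.
by rewrite !inE => Ax Ay; exact: (cA t%:num x y).
Qed.

Lemma polyhedron_convex (R : realType) (n : nat) (P : set 'rV[R]_n) :
  polyhedron P -> convex P.
Proof.
move=> [F [_ FH ->]]; apply/convexP => t x y t0 t1 Fx Fy H FH0.
have [a [b [_ HE]]] := FH _ FH0.
move: (Fx _ FH0) (Fy _ FH0); rewrite HE/= => axb ayb.
rewrite dotvDr !dotvZr.
have -> : b = t * b + (1 - t) * b by ring.
by rewrite lerD// ler_wpM2l// subr_ge0.
Qed.

(** * Cones over lifted sets and the one-sided estimate *)

Section Homogenization.
Variables (R : realType) (n : nat).
Implicit Types (A B C : set 'rV[R]_n) (a b c : 'rV[R]_n).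

(** The vectors of the stated form, together with 0, are themselves a convex cone containing
    [lift1 C], so minimality of [cone] applies. *)
Lemma cone_lift1 C w : convex C -> cone (lift1 C) w ->
  w = 0 \/ exists t c, [/\ 0 < t, C c & w = row_mx (t *: c) (t *: 1%:M)].
Proof.
move=> /convexP cC; pose K := [set w : 'rV[R]_(n + 1) | w = 0 \/
  exists t c, [/\ 0 < t, C c & w = row_mx (t *: c) (t *: 1%:M)]].
suff KP : convex_cone K.
  apply: (@smallest_sub _ _ _ K) => // _ [c Cc <-]; right; exists 1, c.
  by rewrite !scale1r.
have KZ (t : R) x : 0 <= t -> K x -> K (t *: x).
  rewrite le_eqVlt => /predU1P[<- _|t0]; first by left; rewrite scale0r.
  case=> [->|[s [c [s0 Cc ->]]]]; first by left; rewrite scaler0.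
  by right; exists (t * s), c; rewrite mulr_gt0// scale_row_mx !scalerA.
split=> //; first by left.
apply/convexP => t x y t0 t1 Kx Ky.
(* Absorbing both weights into the points reduces convexity to closure under addition. *)
have {}Kx := KZ _ _ t0 Kx.
have {}Ky : K ((1 - t) *: y) by apply: KZ => //; rewrite subr_ge0.
move: (t *: x) ((1 - t) *: y) Kx Ky => {}x {}y.
case=> [->|[r [c [r0 Cc ->]]]]; first by rewrite add0r.
case=> [->|[s [d [s0 Cd ->]]]]; first by rewrite addr0; right; exists r, c.
have rs0 : 0 < r + s by rewrite addr_gt0.
(* The sum of [r (c, 1)] and [s (d, 1)] is [r + s] times the lift of a weighted mean of [c] and
   [d]. *)
right; exists (r + s), (r / (r + s) *: c + (1 - r / (r + s)) *: d).
split=> //.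
  apply: cC => //; first by rewrite divr_ge0// ltW.
  by rewrite ler_pdivrMr// mul1r lerDl ltW.
rewrite add_row_mx -scalerDl scalerDr !scalerA.
have -> : (r + s) * (r / (r + s)) = r by field; rewrite gt_eqF.
by have -> : (r + s) * (1 - r / (r + s)) = s by field; rewrite gt_eqF.
Qed.

(* Testing the one-sided distance at the multiple [r^-1 (a, 1)] of [(a, 1)],
   which lies in the unit ball, gives a point [t (b, 1)] of the other cone with
   [t >= 1 / (2 r)]; dividing by [t] loses a factor of order [r ^ 2]. *)
Lemma homog_near_point A B a (r eps d : R) :
  convex B -> A a -> 1 + enorm a <= r -> 0 < eps -> eps <= 1 ->
  (ereal_sup [set edist_to x (homog B `&` @unit_ball R (n + 1))
             | x in homog A `&` @unit_ball R (n + 1)] <= d%:E)%E ->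
  d < eps / (2 * r ^+ 2) ->
  exists2 b, B b & enorm (a - b) <= eps.
Proof.
move=> cB Aa ar eps0 eps1 supd.
set e := eps / _ => de.
have a0 := enorm_ge0 a.
have r1 : 1 <= r by lra.
have r0 : 0 < r by lra.
have er : eps = 2 * r ^+ 2 * e by rewrite /e; field; rewrite gt_eqF.
(* This smallness, from [eps <= 1 <= r], later keeps the height [t] of the nearby cone point away
   from 0. *)
have es : 2 * e <= r^-1.
  have -> : 2 * e = eps / r * r^-1 by rewrite /e; field; rewrite gt_eqF.
  rewrite ger_pMl ?invr_gt0// ler_pdivrMr// mul1r; exact: le_trans r1.
set s := r^-1 in es.
have s0 : 0 < s by rewrite invr_gt0.
have sr : s * r = 1 by rewrite mulVf// gt_eqF.
have norm1 : enorm (1%:M : 'rV[R]_1) = 1.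
  by rewrite /enorm /dotv big_ord1 mxE eqxx mulr1 sqrtr1.
pose u : 'rV[R]_(n + 1) := row_mx (s *: a) (s *: 1%:M).
have hu : (homog A `&` @unit_ball R (n + 1)) u.
  split.
    apply: subset_closure => K [[_ KZ _] AK].
    by rewrite /u -scale_row_mx; apply: KZ; [exact: ltW|apply: AK; exists a].
  rewrite /unit_ball/= -(@ler_pXn2r _ 2)// ?nnegrE ?enorm_ge0//.
  rewrite enorm_row_mx !enormZ norm1 gtr0_norm// !exprMn expr1n -mulrDr.
  apply: (@le_trans _ _ ((s * r) ^+ 2)); last by rewrite sr.
  rewrite exprMn ler_pM2l ?exprn_gt0//.
  apply: (@le_trans _ _ ((1 + enorm a) ^+ 2)); first by rewrite sqrrD; lra.
  by rewrite ler_pXn2r// nnegrE ?ltW//; lra.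
have : (edist_to u (homog B `&` @unit_ball R (n + 1)) < e%:E)%E.
  apply: (@le_lt_trans _ _ d%:E); last by rewrite lte_fin.
  by apply: le_trans supd; apply: ereal_sup_ubound; exists u.
move=> /ereal_inf_lt[_ [v [hv _] <-]]; rewrite lte_fin => uv.
(* [v] lies only in the closure of the cone; the slack left by the strict inequality pays for moving
   to a point [w] of the cone itself. *)
have [] := (closure_enormP _ _).1 hv (e - enorm (u - v)); first by lra.
move=> w Bw vw.
have {v hv uv vw} uw : enorm (u - w) < e by have := ler_enorm_sub v u w; lra.
have := cone_lift1 cB Bw.
have le_row (x : 'rV[R]_n) (y : 'rV[R]_1) :
    enorm x <= enorm (row_mx x y) /\ enorm y <= enorm (row_mx x y).
  split; rewrite -(@ler_pXn2r _ 2)// ?nnegrE ?enorm_ge0// enorm_row_mx.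
    by rewrite lerDl sqr_ge0.
  by rewrite lerDr sqr_ge0.
case=> [w0|[t [b [t0 Bb wE]]]].
  (* The apex is too far away: [u] has last coordinate [s >= 2 * e], but would have norm less than
     [e]. *)
  have [_] := le_row (s *: a) (s *: 1%:M).
  by rewrite enormZ norm1 gtr0_norm//; move: uw; rewrite w0 subr0 /u; lra.
exists b => //.
move: uw; rewrite wE /u opp_row_mx add_row_mx -scalerBl => uw.
have [ab st] := le_row (s *: a - t *: b) ((s - t) *: 1%:M).
have {st} := le_lt_trans st uw; rewrite enormZ norm1 mulr1 => st.
have {}ab := le_lt_trans ab uw.
have st2 : s <= 2 * t by move: st; rewrite ltr_norml => /andP[_]; lra.
(* Compare [t *: a] with [s *: a]: the height error costs [e * enorm a], the horizontal error [e],
   and [1 + enorm a <= r]. *)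
have tab : t * enorm (a - b) <= e * r.
  rewrite -[t in t * _]gtr0_norm// -enormZ.
  have -> : t *: (a - b) = (s *: a - t *: b) + (t - s) *: a.
    by rewrite scalerBr scalerBl; apply/rowP => i; rewrite !mxE; ring.
  apply: le_trans (ler_enormD _ _) _; rewrite enormZ distrC.
  apply: (@le_trans _ _ (e + e * enorm a)).
    by rewrite lerD// ?(ltW ab)// ler_wpM2r// ltW.
  have -> : e + e * enorm a = e * (1 + enorm a) by ring.
  by rewrite ler_wpM2l//; have := enorm_ge0 (s *: a - t *: b); lra.
(* With [s <= 2 * t] and [s * r = 1]: [s |a - b| <= 2 t |a - b| <= 2 e r = s * eps]. *)
rewrite er -(ler_pM2l s0).
have -> : s * (2 * r ^+ 2 * e) = 2 * (e * (s * r * r)) by ring.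
rewrite sr mul1r.
apply: (@le_trans _ _ (2 * (t * enorm (a - b)))); last by rewrite ler_pM2l.
by rewrite mulrA ler_wpM2r// enorm_ge0.
Qed.

Lemma fattenP A (eps : R) a : 0 < eps ->
  fatten A eps a <-> exists2 b, A b & enorm (a - b) <= eps.
Proof.
move=> eps0; split=> [[b Ab [c c1 <-]]|[b Ab ab]].
  exists b => //; rewrite addrAC subrr add0r enormZ gtr0_norm//.
  by rewrite ger_pMr.
exists b => //; exists (eps^-1 *: (a - b)).
  by rewrite /unit_ball/= enormZ gtr0_norm ?invr_gt0// ler_pdivrMl// mulr1.
by rewrite scalerA mulfV ?gt_eqF// scale1r addrC subrK.
Qed.

Lemma inner_limit_sub_outer (M : nat -> set 'rV[R]_n) :
  inner_limit M `<=` outer_limit M.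
Proof.
move=> x xM e e0; have [N [cN NM]] := xM e e0; exists N; split=> //.
exact: cofinite_set_infinite infinite_nat cN.
Qed.

End Homogenization.

(** * Passage to the limit *)

Lemma cvg0_cofinite_lt (R : realType) (u : nat -> R) (e : R) :
  u k @[k --> \oo] --> (0 : R) -> 0 < e -> cofinite_set [set k | u k < e].
Proof.
move=> u0 e0; have [K _ Ke] := cvgr_lt _ u0 _ e0.
apply: (sub_finite_set _ (finite_II K)) => k /= uk.
by rewrite ltnNge; apply/negP => /Ke /uk.
Qed.

Theorem mainTheorem4 (R : realType) (n : nat) (C : set 'rV[R]_n)
    (delta : nat -> R) (P : nat -> set 'rV[R]_n) :
  closed C -> convex C ->
  (forall k, 0 <= delta k) ->
  delta k @[k --> \oo] --> (0 : R) ->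
  (forall k, homogeneous_approximation (delta k) (P k) C) ->
  PK_converges P C.
Proof.
move=> clC cC _ delta0 PC.
have e0 (eps r : R) : 0 < eps -> 1 <= r -> 0 < eps / (2 * r ^+ 2).
  by move=> eps0 r1; rewrite divr_gt0// mulr_gt0// exprn_gt0//; lra.
have C_inner : C `<=` inner_limit P.
  move=> x Cx eps eps0.
  (* The tolerance is capped at 1 as [homog_near_point] requires. *)
  have m0 : 0 < Num.min 1 eps by rewrite lt_min ltr01.
  exists [set k | delta k < Num.min 1 eps / (2 * (1 + enorm x) ^+ 2)]; split.
    by apply: cvg0_cofinite_lt => //; apply: e0 => //; have := enorm_ge0 x; lra.
  move=> k /= dk; apply/fattenP => //.
  have [_ Pk] := PC k; rewrite /trunc_hausdorff_dist /hausdorff_dist ge_max.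
  move=> /andP[_ CP].
  have [|p Pp xp] := homog_near_point (polyhedron_convex Pk) Cx (lexx _) m0 _ CP dk.
    by rewrite ge_min lexx.
  by exists p => //; apply: le_trans xp _; rewrite ge_min lexx orbT.
have outer_C : outer_limit P `<=` C.
  move=> x xP; rewrite (closure_id C).1//; apply/closure_enormP => eps eps0.
  (* Two steps of length at most [eps / 3], from [x] to [p] and from [p] to [c], stay strictly below
     [eps]. *)
  pose m := Num.min 1 (eps / 3).
  have m0 : 0 < m by rewrite lt_min ltr01 divr_gt0.
  have m1 : m <= 1 by rewrite ge_min lexx.
  have m3 : m <= eps / 3 by rewrite ge_min lexx orbT.
  have [N [Ninf NP]] := xP m m0.
  have x0 := enorm_ge0 x.
  (* The point [p] will depend on [k], but [m <= 1] gives [enorm p <= 1 + enorm x], so the radius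
     [2 + enorm x] can be fixed before [k] is chosen. *)
  have cof : cofinite_set [set k | delta k < m / (2 * (2 + enorm x) ^+ 2)].
    by apply: cvg0_cofinite_lt => //; apply: e0 => //; lra.
  have [k [/= dk Nk]] := infinite_setN0 (infinite_setIr cof Ninf).
  have [p Pp xp] := (fattenP _ _ m0).1 (NP _ Nk).
  have [_ _] := PC k; rewrite /trunc_hausdorff_dist /hausdorff_dist ge_max.
  move=> /andP[PkC _].
  have pr : 1 + enorm p <= 2 + enorm x.
    have := ler_enorm_sub x p 0; rewrite !subr0 enormB; lra.
  have [c Cc pc] := homog_near_point cC Pp pr m0 m1 PkC dk.
  by exists c => //; have := ler_enorm_sub p x c; lra.
(* The inclusions of [C] in the inner limit, of that in the outer limit, and of the latter in [C]
   close a cycle. *)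
by split; apply/seteqP; split=> // x;
  [move=> /C_inner/inner_limit_sub_outer|move=> /inner_limit_sub_outer/outer_C].
Qed.
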